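(* Let $\mathcal{B}$ be a finite relational structure and let $r\in(0,1]$. If \textsc{Max-CSP}$(\mathcal{B})$ is not polynomial-time $r$-approximable, then \textsc{Max-Sur-CSP}$(\mathcal{B})$ is not polynomial-time $r$-approximable.
   Context: For a finite relational signature $\sigma$ with relation symbols $R_1,\dots,R_m$ of arities $k_1,\dots,k_m$, a finite $\sigma$-structure $\mathcal{A}=(A,R_1^{\mathcal{A}},\dots,R_m^{\mathcal{A}})$ consists of a finite set $A$ and relations $R_i^{\mathcal{A}}\subseteq A^{k_i}$; its size is $|\mathcal{A}|=|A|+\sum_i|R_i^{\mathcal{A}}|$. For a fixed finite $\sigma$-structure $\mathcal{B}$, \textsc{Max-CSP}$(\mathcal{B})$ takes as input a finite $\sigma$-structure $\mathcal{A}$ and asks for a function $h:A\to B$ maximizing the number of pairs $(i,(a_1,\dots,a_{k_i}))$ with $(a_1,\dots,a_{k_i})\in R_i^{\mathcal{A}}$ and $(h(a_1),\dots,h(a_{k_i}))\in R_i^{\mathcal{B}}$ (the value of $h$). \textsc{Max-Sur-CSP}$(\mathcal{B})$ is the same problem restricted to instances with $|A|\geq|B|$ and requiring $h$ to be surjective onto $B$. A solution with value $Val$ is $r$-approximate if $Val/Opt\geq r$, where $Opt$ is the optimum of the instance. A problem is polynomial-time $r$-approximable if some algorithm running in time polynomial in $|\mathcal{A}|$ outputs an $r$-approximate solution on every instance. *)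

(* Defs.v *)
From mathcomp Require Import all_boot all_order all_algebra.
From mathcomp Require Import reals.

Set Implicit Arguments.
Unset Strict Implicit.
Unset Printing Implicit Defensive.

Import Order.TTheory GRing.Theory Num.Theory.
Local Open Scope ring_scope.

Record structure (m : nat) (ar : 'I_m -> nat) := Structure {
  carrier :> finType;
  rel_of : forall i : 'I_m, {set (ar i).-tuple carrier} }.

Section MaxCSP.
Variables (m : nat) (ar : 'I_m -> nat).
Implicit Types A B : structure ar.

Definition struct_size A : nat := (#|A| + \sum_(i < m) #|rel_of A i|)%N.

Definition value A B (h : {ffun A -> B}) : nat :=
  (\sum_(i < m) #|[set t in rel_of A i | map_tuple h t \in rel_of B i]|)%N.

Definition surjective A B (h : {ffun A -> B}) : bool :=
  [forall b, exists a, h a == b].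

(* An optimization problem over the template [B] is given by its set of
   instances and, for each instance, its set of solutions. *)
Record csp_problem B := CspProblem {
  instance_of : pred (structure ar);
  solution_of : forall A, pred {ffun A -> B} }.

Definition max_csp B : csp_problem B :=
  CspProblem (fun=> true) (fun A => fun=> true).

Definition max_sur_csp B : csp_problem B :=
  CspProblem (fun A => #|B| <= #|A|)%N (fun A => @surjective A B).

Definition opt B (P : csp_problem B) A : nat :=
  (\max_(h : {ffun A -> B} | solution_of P h) value h)%N.

(* When the optimum is 0 the ratio is undefined; every solution is then
   optimal, and counts as [r]-approximate. *)
Definition approx_solution B (P : csp_problem B) (R : realType) (r : R)
    A (h : {ffun A -> B}) : bool :=
  solution_of P h &&
  ((opt P A == 0%N) || (r <= (value h)%:R / (opt P A)%:R)).

End MaxCSP.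

Inductive move := MoveL | MoveN | MoveR.

Section TuringMachine.
Variables I O : finType.

(* Deterministic one-tape machines with input alphabet [I], output alphabet
   [O] and auxiliary tape symbols [work]; in a cell, [None] is the blank.
   The machine halts when [delta] returns [None]. *)
Record machine := Machine {
  state : finType;
  work : finType;
  start : state;
  delta : state -> option (I + O + work) ->
          option (state * option (I + O + work) * move) }.

Variable M : machine.

Definition cell : Type := option (I + O + work M).

(* The two-way infinite tape: the cells left of the head (nearest first), the
   scanned cell, and the cells right of it; cells beyond the lists are blank. *)
Record config := Config {
  cur : state M;
  lefts : seq cell;
  scanned : cell;
  rights : seq cell }.

Definition move_head q l x r (d : move) : config :=
  match d with
  | MoveL => Config q (behead l) (head None l) (x :: r)
  | MoveN => Config q l x r
  | MoveR => Config q (x :: l) (head None r) (behead r)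
  end.

Definition halted (c : config) : bool := ~~ isSome (delta (cur c) (scanned c)).

Definition step (c : config) : config :=
  if delta (cur c) (scanned c) is Some (q, x, d)
  then move_head q (lefts c) x (rights c) d else c.

Definition init (w : seq I) : config :=
  let s : seq cell := [seq Some (inl (inl a)) | a <- w] in
  Config (start M) [::] (head None s) (behead s).

(* The output is read from the head rightwards up to the first blank. *)
Definition outputs (c : config) (v : seq O) : Prop :=
  let s := scanned c :: rights c in
  take (index None s) s = [seq Some (inl (inr b)) | b <- v].

Definition computes_within (T : nat) (w : seq I) (v : seq O) : Prop :=
  exists k, [/\ (k <= T)%N, halted (iter k step (init w))
              & outputs (iter k step (init w)) v].

End TuringMachine.

Section Encoding.
Variables (m : nat) (ar : 'I_m -> nat) (A : structure ar).

(* Elements are numbered by [enum A]; the number [j] is written in unary as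
   [1^j 0].  Since the size of a structure counts its elements and the arities
   are fixed, the encoding has length polynomial in [struct_size A]. *)
Definition encode_nat (j : nat) : seq bool := rcons (nseq j true) false.

Definition encode_tuple k (t : k.-tuple A) : seq bool :=
  flatten [seq encode_nat (enum_rank a) | a <- t].

(* Each tuple is announced by a 1, and the end of the list is marked by a 0. *)
Definition encode_tuples k (s : seq (k.-tuple A)) : seq bool :=
  rcons (flatten [seq true :: encode_tuple t | t <- s]) false.

(* The tuples of each relation are listed in an arbitrary order, without
   repetition; a machine has to cope with all orders. *)
Definition listing (L : forall i : 'I_m, seq ((ar i).-tuple A)) : Prop :=
  forall i, perm_eq (L i) (enum (rel_of A i)).

Definition encode (L : forall i : 'I_m, seq ((ar i).-tuple A)) : seq bool :=
  encode_nat #|A| ++ flatten [seq encode_tuples (L i) | i <- enum 'I_m].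

Definition encode_solution (B : finType) (h : {ffun A -> B}) : seq B :=
  [seq h a | a <- enum A].

End Encoding.

Definition poly_approximable (m : nat) (ar : 'I_m -> nat) (B : structure ar)
    (P : csp_problem B) (R : realType) (r : R) : Prop :=
  exists (M : machine bool B) (p : {poly nat}),
    forall (A : structure ar) (L : forall i : 'I_m, seq ((ar i).-tuple A)),
      instance_of P A -> listing L ->
      exists2 h : {ffun A -> B}, approx_solution P r h
        & computes_within M p.[struct_size A] (encode L) (encode_solution h).

(* Main.v *)
(** Adding to an instance [A] of Max-CSP as many isolated elements as [B] has
    yields an instance of Max-Sur-CSP with the same optimum: the isolated
    elements make any map surjective, and restricting a map to [A] does not
    change its value.  Isolated elements with the last numbers only prepend
    [#|B|] ones to the encoding of [A] and append [#|B|] symbols to the encoding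
    of a solution, so a machine for Max-Sur-CSP is turned into one for Max-CSP
    by writing these ones before its run and erasing these symbols after it. *)
Require Import Defs.
From mathcomp Require Import all_boot all_order all_algebra.
From mathcomp Require Import reals.
From mathcomp Require Import zify.

Set Implicit Arguments.
Unset Strict Implicit.
Unset Printing Implicit Defensive.

Import Order.TTheory GRing.Theory Num.Theory.
Local Open Scope ring_scope.

(** Since the left summand is listed first, adjoining elements on the right leaves the numbers of
    the old elements unchanged. *)
Lemma enum_sum (T1 T2 : finType) :
  enum {: T1 + T2} = [seq inl x | x <- enum T1] ++ [seq inr y | y <- enum T2].
Proof. by rewrite !enumT [in LHS]unlock. Qed.

Lemma val_enum_rank (T : finType) (x : T) :
  enum_rank x = index x (enum T) :> nat.
Proof.
rewrite -{2}(enum_rankK x) (enum_val_nth x) index_uniq ?enum_uniq //.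
by rewrite -cardE.
Qed.

Lemma nseq_cat_cons (T : Type) k (x : T) s :
  nseq k x ++ x :: s = nseq k.+1 x ++ s.
Proof. by elim: k => [|k IHk] //=; rewrite IHk. Qed.

(** * Instances with isolated elements added *)

Section Isolated.
Variables (m : nat) (ar : 'I_m -> nat).
Implicit Types A B : structure ar.

Definition inl_tuple (S T : finType) k (t : k.-tuple S) :
  k.-tuple (S + T)%type :=
  map_tuple inl t.
Arguments inl_tuple {S} T {k} t.

Lemma inl_tuple_inj (S T : finType) k : injective (@inl_tuple S T k).
Proof.
move=> s t /(congr1 val) /= st; apply: val_inj => /=.
by apply: inj_map st => x y [].
Qed.

Definition add_isolated A (T : finType) : structure ar :=
  Structure (fun i => inl_tuple T @: rel_of A i).

Lemma struct_size_add_isolated A T :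
  struct_size (add_isolated A T) = (struct_size A + #|T|)%N.
Proof.
rewrite /struct_size card_sum addnAC; congr (_ + _ + _)%N.
by apply: eq_bigr => i _; rewrite card_imset //; apply: inl_tuple_inj.
Qed.

(** A machine has to cope with every order of the tuples, so the order of [L] can be kept and no
    reordering is left to the reduction. *)
Definition inl_listing A (T : finType)
    (L : forall i : 'I_m, seq ((ar i).-tuple A))
    (i : 'I_m) : seq ((ar i).-tuple (add_isolated A T)) :=
  [seq inl_tuple T t | t <- L i].

Lemma listing_inl A T L : listing L -> listing (@inl_listing A T L).
Proof.
move=> listL i; apply: uniq_perm; rewrite ?enum_uniq //.
  rewrite (map_inj_uniq (@inl_tuple_inj _ _ _)).
  by rewrite (perm_uniq (listL i)) enum_uniq.
move=> t; rewrite mem_enum; apply/mapP/imsetP => -[s sL ->]; exists s => //.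
  by rewrite -mem_enum -(perm_mem (listL i)).
by rewrite (perm_mem (listL i)) mem_enum.
Qed.

(** Old elements keep their ranks and tuples their order, so only the leading cardinality changes;
    being unary, it grows by ones on its left. *)
Lemma encode_inl_listing A (T : finType)
    (L : forall i : 'I_m, seq ((ar i).-tuple A)) :
  encode (inl_listing T L) = nseq #|T| true ++ encode L.
Proof.
rewrite /encode card_sum catA; congr (_ ++ _).
  by rewrite /encode_nat addnC nseqD rcons_cat.
congr flatten; apply: eq_map => i.
rewrite /encode_tuples -map_comp; congr (rcons (flatten _) _).
apply: eq_map => t /=.
congr cons; rewrite /encode_tuple /= -map_comp; congr flatten.
apply: eq_map => a /=; congr encode_nat.
rewrite !val_enum_rank enum_sum index_cat mem_map; last by move=> x y [].
by rewrite mem_enum index_map //; move=> x y [].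
Qed.

Definition restrict_inl A B (T : finType) (h : {ffun add_isolated A T -> B}) :
  {ffun A -> B} := [ffun a => h (inl a)].

(** No tuple of a relation contains an isolated element, so the value does not depend on the images
    of these elements. *)
Lemma value_restrict_inl A B T (h : {ffun add_isolated A T -> B}) :
  value (restrict_inl h) = value h.
Proof.
rewrite /value; apply: eq_bigr => i _.
rewrite -(card_imset _ (@inl_tuple_inj A T _)); apply: eq_card => t.
have mapE s : map_tuple h (inl_tuple T s) = map_tuple (restrict_inl h) s.
  apply: val_inj; rewrite /= -map_comp; apply: eq_map => a /=.
  by rewrite ffunE.
rewrite inE; apply/imsetP/andP => [[s]|[/imsetP[s sA ->]]].
  by rewrite inE => /andP[sA sB] ->; rewrite mapE imset_f.
by rewrite mapE => sB; exists s; rewrite // inE sA.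
Qed.

Definition extend_id A B (h : {ffun A -> B}) : {ffun add_isolated A B -> B} :=
  [ffun x => match x with inl a => h a | inr b => b end].

Lemma surjective_extend_id A B (h : {ffun A -> B}) : surjective (extend_id h).
Proof. by apply/forallP => b; apply/existsP; exists (inr b); rewrite ffunE. Qed.

Lemma extend_idK A B : cancel (@extend_id A B) (@restrict_inl A B B).
Proof. by move=> h; apply/ffunP => a; rewrite !ffunE. Qed.

Lemma opt_add_isolated A B :
  opt (max_sur_csp B) (add_isolated A B) = opt (max_csp B) A.
Proof.
apply/eqP; rewrite eqn_leq; apply/andP; split; apply/bigmax_leqP => h _.
  by rewrite -value_restrict_inl; apply: leq_bigmax_cond.
(* As [h] is the restriction of [extend_id h], both have the same value, and the latter is
   surjective. *)
rewrite -[h]extend_idK value_restrict_inl.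
exact: leq_bigmax_cond (surjective_extend_id h).
Qed.

Lemma approx_solution_restrict_inl A B (R : realType) (r : R)
    (h : {ffun add_isolated A B -> B}) :
  approx_solution (max_sur_csp B) r h ->
  approx_solution (max_csp B) r (restrict_inl h).
Proof.
by rewrite /approx_solution opt_add_isolated value_restrict_inl => /andP[].
Qed.

Lemma encode_solution_restrict_inl A B (T : finType)
    (h : {ffun add_isolated A T -> B}) :
  encode_solution h =
  encode_solution (restrict_inl h) ++ [seq h (inr b) | b <- enum T].
Proof.
rewrite /encode_solution enum_sum map_cat -!map_comp; congr (_ ++ _).
by apply: eq_map => a; rewrite /= ffunE.
Qed.

End Isolated.

(** * A machine that pads the input and trims the output *)

Section Padding.
Variables (I O : finType) (M : machine I O) (n : nat) (pad : I).

Definition pad_state : finType :=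
  ('I_n.+1 + state M + 'I_n.+1 + option bool)%type.

(* [st_fill k]: [k] symbols remain to be written after the scanned one. *)
Definition st_fill k : pad_state := inl (inl (inl (inord k))).
Definition st_run (q : state M) : pad_state := inl (inl (inr q)).
Definition st_clear : pad_state := inr (Some true).
Definition st_seek : pad_state := inr (Some false).
(* Once [k = 0], the head returns to the start of the output. *)
Definition st_erase k : pad_state := inl (inr (inord k)).
Definition st_done : pad_state := inr None.

(* Before the return, [st_clear] makes the cell left of the output blank, so
   that the start of the output can be recognized. *)
Definition pad_delta (q : pad_state) (x : cell M) :
    option (pad_state * cell M * move) :=
  match q with
  | inl (inl (inl k)) =>
      let y := if k == n :> nat then x else Some (inl (inl pad)) in
      if nat_of_ord k is k'.+1 then Some (st_fill k', y, MoveL)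
      else Some (st_run (start M), y, MoveN)
  | inl (inl (inr p)) =>
      if delta p x is Some (p', y, d) then Some (st_run p', y, d)
      else Some (st_clear, x, MoveL)
  | inl (inr k) =>
      if nat_of_ord k is k'.+1 then Some (st_erase k', None, MoveL)
      else if isSome x then Some (q, x, MoveL) else Some (st_done, None, MoveR)
  | inr (Some true) => Some (st_seek, None, MoveR)
  | inr (Some false) =>
      if isSome x then Some (q, x, MoveR) else Some (st_erase n, None, MoveL)
  | inr None => None
  end.

Definition pad_machine : machine I O := Machine (st_fill n) pad_delta.
Notation M' := pad_machine.

Definition pad_config (q : pad_state) (l : seq (cell M)) x r : config M' :=
  @Config _ _ M' q l x r.

Definition embed (c : config M) : config M' :=
  pad_config (st_run (cur c)) (lefts c) (scanned c) (rights c).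

Lemma step_fill k l x r : (k <= n)%N ->
  step (pad_config (st_fill k) l x r) =
  let y := if k == n then x else Some (inl (inl pad)) in
  if k is k'.+1 then pad_config (st_fill k') (behead l) (head None l) (y :: r)
  else pad_config (st_run (start M)) l y r.
Proof. by move=> kn; rewrite /step /= inordK //; case: k kn. Qed.

Lemma step_erase k l x r : (k < n)%N ->
  step (pad_config (st_erase k.+1) l x r) =
  pad_config (st_erase k) (behead l) (head None l) (None :: r).
Proof. by move=> kn; rewrite /step /= inordK. Qed.

Lemma step_return l x r :
  step (pad_config (st_erase 0) l x r) =
  if x is Some _ then pad_config (st_erase 0) (behead l) (head None l) (x :: r)
  else pad_config st_done (None :: l) (head None r) (behead r).
Proof. by rewrite /step /= inordK //; case: x. Qed.

(** The counter equals [n] only on the first input symbol, which must survive; below [n], every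
    scanned cell receives [pad]. *)
Lemma iter_fill k x r : (k < n)%N ->
  iter k.+1 (@step _ _ M') (pad_config (st_fill k) [::] x r) =
  pad_config (st_run (start M)) [::] (Some (inl (inl pad)))
    (nseq k (Some (inl (inl pad))) ++ r).
Proof.
elim: k x r => [|k IHk] x r kn;
  rewrite iterSr step_fill ?(ltnW kn) // ltn_eqF //.
by rewrite IHk ?(ltnW kn) // nseq_cat_cons.
Qed.

(** One step leaves the first symbol of [w] in place and [n] steps write the padding. For empty [w]
    and positive [n], the scanned blank would become an explicit last entry of [rights], and the two
    records would differ. *)
Lemma iter_init w : w != [::] ->
  iter n.+1 (@step _ _ M') (init M' w) = embed (init M (nseq n pad ++ w)).
Proof.
case: w => [//|a w _].
suff gen k : k = n -> iter k.+1 (@step _ _ M')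
    (pad_config (st_fill k) [::] (Some (inl (inl a)))
      [seq Some (inl (inl b)) | b <- w])
  = embed (init M (nseq k pad ++ a :: w)) by exact: gen.
case: k => [|k] kn; rewrite iterSr step_fill -?kn // eqxx //.
by rewrite iter_fill -?kn // /embed /= map_cat map_nseq.
Qed.

Lemma halted_step (c : config M) : halted c -> step c = c.
Proof. by rewrite /halted /step; case: delta. Qed.

Lemma step_embed (c : config M) :
  ~~ halted c -> step (embed c) = embed (step c).
Proof.
rewrite /halted /step /=; case: delta => [[[q x] d]|] //= _.
by case: d.
Qed.

(** Once [M] halts, its further iterations are idle, whereas the padded machine would start
    trimming; hence [k'] may be smaller than [k]. *)
Lemma iter_embed k (c : config M) :
  exists2 k', (k' <= k)%N &
    iter k' (@step _ _ M') (embed c) = embed (iter k (@step _ _ M) c).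
Proof.
elim: k c => [|k IHk] c; first by exists 0%N.
have [hc|nhc] := boolP (halted c).
  have [k' k'k eqk] := IHk c; exists k'; first exact: leqW.
  by rewrite iterSr halted_step.
have [k' k'k eqk] := IHk (step c); exists k'.+1 => //.
by rewrite !iterSr step_embed.
Qed.

(** Writing the scanned cell and its right side as [head None] and [behead] of one list makes the
    end of the list read as a blank. *)
Lemma iter_seek l (s t : seq (cell M)) : all isSome s ->
  iter (size s) (@step _ _ M')
    (pad_config st_seek l (head None (s ++ t)) (behead (s ++ t)))
  = pad_config st_seek (rev s ++ l) (head None t) (behead t).
Proof.
elim: s l => [|x s IHs] l //= /andP[xS sS];
  rewrite -/(iter (size s).+1 _ _) iterSr.
have -> : step (pad_config st_seek l x (s ++ t)) =
    pad_config st_seek (x :: l) (head None (s ++ t)) (behead (s ++ t)).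
  by case: x xS.
by rewrite IHs // rev_cons cat_rcons.
Qed.

Lemma iter_erase (s l r : seq (cell M)) : (size s <= n)%N ->
  iter (size s) (@step _ _ M')
    (pad_config (st_erase (size s)) (behead (s ++ l)) (head None (s ++ l)) r)
  = pad_config (st_erase 0) (behead l) (head None l) (nseq (size s) None ++ r).
Proof.
elim: s r => [|x s IHs] r //= sn;
  rewrite -/(iter (size s).+1 _ _) iterSr step_erase //.
by rewrite (IHs (None :: r)) ?(ltnW sn) // nseq_cat_cons.
Qed.

Lemma iter_return (s l r : seq (cell M)) : all isSome s ->
  iter (size s) (@step _ _ M')
    (pad_config (st_erase 0) (behead (s ++ l)) (head None (s ++ l)) r)
  = pad_config (st_erase 0) (behead l) (head None l) (rev s ++ r).
Proof.
elim: s r => [|x s IHs] r //= /andP[xS sS];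
  rewrite -/(iter (size s).+1 _ _) iterSr step_return.
by case: x xS => // x _; rewrite (IHs (Some x :: r)) // rev_cons cat_rcons.
Qed.

Definition output_cells (v : seq O) : seq (cell M) :=
  [seq Some (inl (inr b)) | b <- v].

Lemma all_isSome_output_cells v : all isSome (output_cells v).
Proof. by elim: v. Qed.

(** The blank that ends the output may be stored in the list or lie beyond its end;
    [head None t = None] covers both cases. *)
Lemma outputs_catP (c : config M) v : outputs c v ->
  exists2 t, scanned c :: rights c = output_cells v ++ t & head None t = None.
Proof.
rewrite /outputs /output_cells; set s := _ :: _ => <-.
exists (drop (index None s) s); first by rewrite cat_take_drop.
rewrite -nth0 nth_drop addn0.
have [sN|sN] := boolP (None \in s); first exact: nth_index.
by rewrite nth_default // memNindex.
Qed.

Lemma outputs_cat (c : config M') v t :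
  scanned c :: rights c = output_cells v ++ None :: t -> outputs c v.
Proof.
rewrite /outputs => ->; rewrite index_cat /=.
have -> : None \in output_cells v = false by apply/negP => /mapP[].
by rewrite addn0 take_size_cat.
Qed.

Lemma iter_erase_output (c : config M) u u' :
  halted c -> outputs c (u ++ u') -> size u' = n ->
  exists l t, iter (2 * size u + 2 * n + 4) (@step _ _ M') (embed c) =
    pad_config st_done l (head None (output_cells u ++ None :: t))
      (behead (output_cells u ++ None :: t)).
Proof.
move=> hc /outputs_catP[t ct tN] u'n.
(* The leading [None] is the blank written by [st_clear]. *)
set l := None :: behead (lefts c).
(* After [u] come the [n] erased cells and the blank that ended the output; one of these blanks is
   the explicit [None] of the statement. *)
exists l, (nseq n None ++ behead t).
(* From right to left: clear and come back, seek the end, turn around, erase [u'], return over [u],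
   stop on its first cell. *)
have -> : (2 * size u + 2 * n + 4 =
    1 + (size u + (n + (1 + (size (u ++ u') + 2)))))%N.
  by rewrite size_cat u'n; lia.
have step2 : iter 2 (@step _ _ M') (embed c) = pad_config st_seek l
    (head None (output_cells (u ++ u') ++ t))
    (behead (output_cells (u ++ u') ++ t)).
  rewrite -ct /= {2}/step /=; move: hc; rewrite /halted.
  by case: delta.
rewrite !iterD step2.
rewrite -[size (u ++ u')](size_map (fun b => Some (inl (inr b)) : cell M)).
rewrite iter_seek ?all_isSome_output_cells // tN.
rewrite /output_cells map_cat rev_cat -catA.
set us := map _ u; set us' := map _ u'.
have := @iter_erase (rev us') (rev us ++ l) (None :: behead t).
have -> : size (rev us') = n by rewrite size_rev size_map.
move=> /(_ (leqnn n)) eraseE.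
have -> : iter 1 (@step _ _ M')
    (pad_config st_seek (rev us' ++ rev us ++ l) None (behead t)) =
  pad_config (st_erase n) (behead (rev us' ++ rev us ++ l))
    (head None (rev us' ++ rev us ++ l)) (None :: behead t) by [].
rewrite eraseE.
have -> : size u = size (rev us) by rewrite size_rev size_map.
rewrite iter_return ?all_rev ?all_isSome_output_cells // revK.
by rewrite nseq_cat_cons; apply: (step_return (behead l) None).
Qed.

(** The overhead is [n + 1] steps for the padding and [2 * size u + 2 * n + 4] for the trimming. *)
Lemma pad_machine_computes T w u u' :
  w != [::] -> size u' = n -> computes_within M T (nseq n pad ++ w) (u ++ u') ->
  computes_within M' (T + 2 * size u + 3 * n + 5) w u.
Proof.
move=> w0 u'n [k [kT hk ok]].
have [k' k'k runE] := iter_embed k (init M (nseq n pad ++ w)).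
have [l [t eraseE]] := iter_erase_output hk ok u'n.
exists ((2 * size u + 2 * n + 4) + (k' + n.+1))%N.
rewrite iterD (iterD k') iter_init // runE eraseE; split; [lia|by []|].
apply: (@outputs_cat _ _ t) => /=.
by case: output_cells.
Qed.

End Padding.

(** * The polynomial-time reduction *)

Lemma encode_neq0 (m : nat) (ar : 'I_m -> nat) (A : structure ar)
    (L : forall i : 'I_m, seq ((ar i).-tuple A)) : encode L != [::].
Proof. by rewrite /encode /encode_nat; case: #|A|. Qed.

Theorem theorem1 (m : nat) (ar : 'I_m -> nat) (B : structure ar)
    (R : realType) (r : R) (hr : 0 < r <= 1) :
  ~ poly_approximable (max_csp B) r -> ~ poly_approximable (max_sur_csp B) r.
Proof.
apply: contra_not => -[M [p Mp]].
(* The symbol [true] is the unary digit. The polynomial bounds the run of [M] on the enlarged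
   instance plus the overhead for [n = #|B|], where the output length [#|A|] is at most the size of
   [A]. *)
exists (pad_machine M #|B| true),
  (p \Po ('X + #|B|%:P) + 2%N%:P * 'X + (3 * #|B| + 5)%N%:P).
move=> A L _ listL.
have [||h h_approx h_comp] := Mp (add_isolated A B) (inl_listing B L).
- by rewrite /= card_sum leq_addl.
- exact: listing_inl.
exists (restrict_inl h); first exact: approx_solution_restrict_inl.
move: h_comp; rewrite encode_inl_listing encode_solution_restrict_inl.
rewrite struct_size_add_isolated.
move/pad_machine_computes; rewrite encode_neq0 size_map -cardE.
move=> /(_ isT erefl)[k [kT hk ok]].
exists k; split=> //; apply: leq_trans kT _.
rewrite 2!hornerD horner_comp hornerD hornerM hornerX !hornerC.
have leA : (#|A| <= struct_size A)%N by apply: leq_addr.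
(* The semiring operations of [nat] are convertible to [addn] and [muln], so the evaluated
   polynomial is restated in plain arithmetic. *)
rewrite -[leqRHS]/(
  p.[(struct_size A + #|B|)%N] + 2 * struct_size A + (3 * #|B| + 5))%N.
by rewrite size_map -cardE [leqRHS]addnA !leq_add2r leq_add2l leq_mul2l.
Qed.
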